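(* Let $\mathcal{H}$ be a complex Hilbert space, let $A\in\mathcal{B}(\mathcal{H})$ be a binormal operator and $B\in\mathcal{B}(\mathcal{H})$ a normal operator such that $AB=\lambda BA\neq 0$, where $\lambda\in\mathbb{C}$. If $|\lambda|=1$, then $AB$ is a binormal operator.
   Context: $\mathcal{B}(\mathcal{H})$ denotes the algebra of all bounded linear operators on the complex Hilbert space $\mathcal{H}$. An operator $T\in\mathcal{B}(\mathcal{H})$ is normal if $T^*T=TT^*$, and binormal if $(T^*T)(TT^* )=(TT^* )(T^*T)$. *)

(* Defs.v *)
From HB Require Import structures.
From mathcomp Require Import all_boot all_order all_algebra.
From mathcomp Require Import all_classical all_reals all_analysis.
From mathcomp Require Import ring lra.
From mathcomp.real_closed Require Import complex.

Set Implicit Arguments.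
Unset Strict Implicit.
Unset Printing Implicit Defensive.

Import Order.TTheory GRing.Theory Num.Theory.
Import numFieldNormedType.Exports.
Local Open Scope classical_set_scope.
Local Open Scope ring_scope.
Local Open Scope complex_scope.

(* {dot H for conj} is linear in its first argument and conjugate-linear in the
   second; norms of H and of R[i] take values in R[i]. *)
HB.mixin Record isHilbert (R : realType) H & CompleteNormedModule R[i] H := {
  inner : {dot H for Num.conj};
  inner_normE : forall x : H, inner x x = `|x| ^+ 2
}.

#[short(type="hilbertType")]
HB.structure Definition Hilbert (R : realType) :=
  {H of CompleteNormedModule R[i] H & isHilbert R H}.

Section BoundedOperators.
Variables (R : realType) (H : hilbertType R).

Definition bounded_linear : {pred H -> H} := fun f =>
  `[< linear f /\ exists M : R, forall x, `|f x| <= M%:C * `|x| >].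

Lemma bounded_linearP f : reflect
  (linear f /\ exists M : R, forall x, `|f x| <= M%:C * `|x|)
  (f \in bounded_linear).
Proof. exact: asboolP. Qed.

Fact bounded_linear_submod_closed : submod_closed bounded_linear.
Proof.
split=> [|a f g /bounded_linearP[lf [M fM]] /bounded_linearP[lg [N gN]]].
  apply/bounded_linearP; split=> [a x y|]; first by rewrite scaler0 addr0.
  by exists 0 => x; rewrite normr0 mul0r.
apply/bounded_linearP; split=> [b x y|].
  change (a *: f (b *: x + y) + g (b *: x + y) =
    b *: (a *: f x + g x) + (a *: f y + g y)).
  by rewrite lf lg !scalerDr !scalerA (mulrC a b) addrACA.
exists (complex.Re `|a| * M + N) => x.
change (`|a *: f x + g x| <= (complex.Re `|a| * M + N)%:C * `|x|).
rewrite (le_trans (ler_normD _ _))// rmorphD rmorphM/= mulrDl normrZ.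
have <- : `|a| = (complex.Re `|a|)%:C by case: a.
by rewrite lerD// -mulrA ler_wpM2l.
Qed.

HB.instance Definition _ :=
  GRing.isSubmodClosed.Build R[i] (H -> H) bounded_linear
    bounded_linear_submod_closed.

(* B(H); multiplication below is composition *)
Record bop := BOp { bop_fun :> H -> H; _ : bop_fun \in bounded_linear }.

HB.instance Definition _ := [isSub for bop_fun].
HB.instance Definition _ := [Choice of bop by <:].
HB.instance Definition _ := [SubChoice_isSubLmodule of bop by <:].

Implicit Types (A B S T : bop) (x y v : H).

Lemma bop_eqP A B : A =1 B <-> A = B.
Proof. by split=> [AB|->//]; apply/val_inj/funext. Qed.

Lemma bop_linear A : linear A.
Proof. by case: A => f /= /bounded_linearP[]. Qed.

HB.instance Definition _ A :=
  GRing.isLinear.Build R[i] H H *:%R A (bop_linear A).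

Lemma bop_bounded A : exists M : R, forall x, `|A x| <= M%:C * `|x|.
Proof. by case: A => f /= /bounded_linearP[]. Qed.

Lemma bopDE A B x : (A + B) x = A x + B x. Proof. by []. Qed.
Lemma bopNE A x : (- A) x = - A x. Proof. by []. Qed.
Lemma bop0E x : (0 : bop) x = 0. Proof. by []. Qed.
Lemma bopZE (a : R[i]) A x : (a *: A) x = a *: A x. Proof. by []. Qed.

Fact bop_one_subproof : (@id H) \in bounded_linear.
Proof. by apply/bounded_linearP; split=> //; exists 1 => x; rewrite mul1r. Qed.

Fact bop_mul_subproof A B : (A \o B) \in bounded_linear.
Proof.
have [M AM] := bop_bounded A; have [N BN] := bop_bounded B.
apply/bounded_linearP; split=> [a x y|]; first by rewrite /= !linearP.
exists (`|M| * N) => x /=; rewrite (le_trans (AM _))//.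
rewrite rmorphM -mulrA (@le_trans _ _ (`|M|%:C * `|B x|))//.
  by rewrite ler_wpM2r// lecR ler_norm.
by rewrite ler_wpM2l// lecR.
Qed.

Definition bop_one := BOp bop_one_subproof.
Definition bop_mul A B := BOp (bop_mul_subproof A B).

Fact bop_mulA : associative bop_mul.
Proof. by move=> A B S; apply/bop_eqP. Qed.
Fact bop_mul1l : left_id bop_one bop_mul.
Proof. by move=> A; apply/bop_eqP. Qed.
Fact bop_mul1r : right_id bop_one bop_mul.
Proof. by move=> A; apply/bop_eqP. Qed.
Fact bop_mulDl : left_distributive bop_mul +%R.
Proof. by move=> A B S; apply/bop_eqP. Qed.
Fact bop_mulDr : right_distributive bop_mul +%R.
Proof. by move=> A B S; apply/bop_eqP => x; rewrite /= linearD. Qed.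

(* only a pzRingType: 1 = 0 when H is the zero space *)
HB.instance Definition _ := GRing.Zmodule_isPzRing.Build bop
  bop_mulA bop_mul1l bop_mul1r bop_mulDl bop_mulDr.

Lemma bop1E x : (1 : bop) x = x. Proof. by []. Qed.
Lemma bopME A B x : (A * B) x = A (B x). Proof. by []. Qed.

Lemma bop_scaleAl (a : R[i]) A B : a *: (A * B) = (a *: A) * B.
Proof. exact/bop_eqP. Qed.

Lemma bop_scaleAr (a : R[i]) A B : a *: (A * B) = A * (a *: B).
Proof. by apply/bop_eqP => x; rewrite bopME !bopZE linearZ. Qed.

End BoundedOperators.

Section Riesz.
Variables (R : realType) (H : hilbertType R).
Implicit Types (x y v : H) (t : R).

Let rip x y : R := complex.Re (inner x y).
Let rn x : R := complex.Re `|x|.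

Lemma innerC x y : inner x y = (inner y x)^*%C.
Proof. by rewrite hermC/= expr0 mul1r. Qed.

Let ripC x y : rip x y = rip y x.
Proof. by rewrite /rip innerC; case: (inner y x). Qed.

Let ripDl x y v : rip (x + y) v = rip x v + rip y v.
Proof. by rewrite /rip linearDl raddfD. Qed.

Let ripDr x y v : rip v (x + y) = rip v x + rip v y.
Proof. by rewrite ripC ripDl !(ripC v). Qed.

Let ripZl t x y : rip (t%:C *: x) y = t * rip x y.
Proof.
by rewrite /rip linearZl_LR /=; case: (inner x y) => a b /=; rewrite mul0r subr0.
Qed.

Let ripZr t x y : rip x (t%:C *: y) = t * rip x y.
Proof. by rewrite ripC ripZl ripC. Qed.

Let normE x : `|x| = (rn x)%:C.
Proof.
by have := normr_ge0 x; rewrite lecE /rn; case: `|x| => a b /= /andP[/eqP->].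
Qed.

Let rn_ge0 x : 0 <= rn x.
Proof. by have := normr_ge0 x; rewrite normE lecR. Qed.

Let ripxx x : rip x x = rn x ^+ 2.
Proof. by rewrite /rip inner_normE normE -rmorphXn. Qed.

Let rn_eq0 x : rn x = 0 -> x = 0.
Proof. by move=> x0; apply/normr0_eq0; rewrite normE x0. Qed.

Let rip_CS x y : (rip x y) ^+ 2 <= rn x ^+ 2 * rn y ^+ 2.
Proof.
have [y0|yn0] := eqVneq (rn y) 0.
  by rewrite (rn_eq0 y0) /rip linear0r /= expr0n/= mulr_ge0// sqr_ge0.
have y2 : 0 < rn y ^+ 2 by rewrite exprn_gt0// lt0r yn0 rn_ge0.
have := sqr_ge0 (rn ((rn y ^+ 2)%:C *: x + (- rip x y)%:C *: y)).
rewrite -[X in _ <= X]ripxx ripDl !ripDr !ripZl !ripZr (ripC y x) !ripxx => h.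
by rewrite -subr_ge0 -(pmulr_rge0 _ y2); apply: le_trans h _; rewrite le_eqVlt;
  apply/orP; left; apply/eqP; ring.
Qed.

Section RealRiesz.
Variables (f : H -> R) (M : R).
Hypothesis fD : forall x y, f (x + y) = f x + f y.
Hypothesis fZ : forall t x, f (t%:C *: x) = t * f x.
Hypothesis fM : forall x, `|f x| <= M * rn x.

Let J x := rn x ^+ 2 - 2 * f x.
Let d := inf (range J).

Let J_lb : has_lbound (range J).
Proof.
exists (- M ^+ 2) => _ [x _ <-]; have := le_trans (ler_norm _) (fM x).
have := sqr_ge0 (rn x - M); rewrite /J; nra.
Qed.

Let dJ x : d <= J x.
Proof. by apply: ge_inf => //; exists x. Qed.

Let S (e : R) : set H := [set x | J x < d + e].

Let S_ne e : 0 < e -> S e !=set0.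
Proof.
move=> e0; have [|_ [x _ <-] xe] := inf_adherent (E := range J) e0; last by exists x.
by split=> //; exists (J 0); exists 0.
Qed.

Let S_dist e x y : S e x -> S e y -> rn (x - y) ^+ 2 <= 4 * e.
Proof.
rewrite /S /= => Sx Sy; have := dJ (2^-1%:C *: (x + y)).
have -> : x - y = x + (-1)%:C *: y by rewrite rmorphN1 scaleN1r.
move: Sx Sy; rewrite /J -!ripxx fZ fD ripZl ripZr !ripDl !ripDr.
by rewrite !ripZl !ripZr (ripC y x); lra.
Qed.

Let S_grad e x v : S e x -> (rip x v - f v) ^+ 2 <= e * rn v ^+ 2.
Proof.
rewrite /S /= => Sx; set a := rip x v - f v.
have [v0|vn0] := eqVneq (rn v) 0.
  rewrite v0 expr0n/= mulr0 /a (rn_eq0 v0).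
  have -> : f 0 = 0 by rewrite -(scale0r 0) -[0 : R[i]]/((0 : R)%:C) fZ mul0r.
  by rewrite /rip linear0r /= subr0 expr0n.
have v2 : 0 < rn v ^+ 2 by rewrite exprn_gt0// lt0r vn0 rn_ge0.
have h t : - e <= 2 * t * a + t ^+ 2 * rn v ^+ 2.
  have := dJ (x + t%:C *: v); move: Sx; rewrite /J -!ripxx fD fZ.
  rewrite !ripDl !ripDr !ripZl !ripZr (ripC v x) /a; lra.
have := h (- a / rn v ^+ 2).
have -> : 2 * (- a / rn v ^+ 2) * a + (- a / rn v ^+ 2) ^+ 2 * rn v ^+ 2 =
  - (a ^+ 2 / rn v ^+ 2) by field.
by rewrite lerN2 ler_pdivrMr.
Qed.

Let S_cvg : exists u, forall e, 0 < e -> forall r, 0 < r ->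
  exists2 x, S e x & rn (u - x) < r.
Proof.
pose F := filter_from [set e : R | 0 < e] S.
have FF : Filter F.
  apply: filter_from_filter; first by exists 1; rewrite /= ltr01.
  move=> e r /= e0 r0; exists (Num.min e r); first by rewrite /= lt_min e0.
  by move=> x; rewrite /S /= => xer; split;
    apply: lt_le_trans xer _; rewrite lerD2l ge_min lexx ?orbT.
have PF : ProperFilter F by apply: filter_from_proper => // e; exact: S_ne.
have Fc : cauchy F.
  apply/cauchyP => _ /posnumP[e].
  have : 0 < (e%:num : R[i]) by [].
  rewrite ltcE => /andP[/= /eqP ei er].
  set r := complex.Re e%:num in er.
  have eE : e%:num = r%:C :> R[i].
    by move: ei; rewrite /r; case: (e%:num : R[i]) => a b /= ->.
  have r0 : 0 < r ^+ 2 / 8 by rewrite divr_gt0// exprn_gt0.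
  have [x Sx] := S_ne r0; exists x; exists (r ^+ 2 / 8) => // y Sy.
  rewrite -ball_normE /= eE normE ltcR -(@ltr_pXn2r _ 2)// ?nnegrE ?rn_ge0 ?ltW//.
  by apply: le_lt_trans (S_dist Sx Sy) _; nra.
have /cvg_ex[l Fl] : cvg F by exact: cauchy_cvg.
exists l => e e0 r r0.
have FSe : F (S e) by exists e.
have rC : 0 < r%:C :> R[i] by rewrite ltcR.
have Fr : F [set x | `|l - x| < r%:C].
  exact: (@cvgr_dist_lt _ _ _ F _ id l Fl _ rC).
have [x [Sx]] := filter_ex (filterI FSe Fr); rewrite /=.
by rewrite normE ltcR => xr; exists x.
Qed.

Lemma real_riesz : exists u, forall v, f v = rip v u.
Proof.
have [u uP] := S_cvg; exists u => v.
suff : rip u v - f v = 0 by rewrite ripC; lra.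
set c := rip u v - f v; apply/eqP; apply/negPn/negP => c0.
have [v0|vn0] := eqVneq (rn v) 0.
  move: c0; rewrite /c (rn_eq0 v0).
  have -> : f 0 = 0 by rewrite -(scale0r 0) -[0 : R[i]]/((0 : R)%:C) fZ mul0r.
  by rewrite /rip linear0r /= subr0 eqxx.
have v1 : 0 < rn v by rewrite lt0r vn0 rn_ge0.
have v2 : 0 < rn v ^+ 2 by rewrite exprn_gt0.
pose r := `|c| / (2 * rn v).
have r0 : 0 < r by rewrite divr_gt0 ?normr_gt0// mulr_gt0.
have rE : 4 * r ^+ 2 * rn v ^+ 2 = c ^+ 2.
  by rewrite /r expr_div_n real_normK ?num_real//; field.
have [x Sx ux] := uP (r ^+ 2) (exprn_gt0 2 r0) r r0.
have h1 := S_grad v Sx; have h2 := rip_CS (u - x) v.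
have h3 : rn (u - x) ^+ 2 < r ^+ 2 by rewrite ltr_pXn2r// ?nnegrE ?rn_ge0 ?ltW.
have h4 : c = rip (u - x) v + (rip x v - f v).
  have -> : u - x = u + (-1)%:C *: x by rewrite rmorphN1 scaleN1r.
  by rewrite ripDl ripZl /c; ring.
move: h3; rewrite -(ltr_pM2r v2) => h3.
have := sqr_ge0 (rip (u - x) v - (rip x v - f v)).
move: rE; rewrite h4; lra.
Qed.

End RealRiesz.

Theorem riesz (f : H -> R[i]) : linear f ->
  (exists M : R, forall x, `|f x| <= M%:C * `|x|) ->
  exists u : H, forall v, f v = inner v u.
Proof.
move=> lf [M fM].
have fD x y : f (x + y) = f x + f y by rewrite -[x in LHS]scale1r lf scale1r.
have f0 : f 0 = 0 by have := fD 0 0; rewrite addr0 -{1}[f 0]addr0 => /addrI.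
have fZ a x : f (a *: x) = a * f x by rewrite -[a *: x]addr0 lf f0 addr0.
have [|||u uP] := @real_riesz (fun x => complex.Re (f x)) M.
- by move=> x y; rewrite fD raddfD.
- by move=> t x; rewrite fZ; case: (f x) => a b /=; rewrite mul0r subr0.
- move=> x; rewrite -lecR rmorphM /= -normE.
  by apply: le_trans (normc_ge_Re _) (fM x).
exists u => v; apply/eqP; rewrite eq_complex uP eqxx /=.
have := uP ('i%C *: v); rewrite fZ /rip linearZl_LR /=.
by case: (f v) (inner v u) => [a b] [a' b'] /=; rewrite !mul0r !mul1r !sub0r => /oppr_inj->.
Qed.

Lemma inner_CS x y : `|inner x y| <= `|x| * `|y|.
Proof.
have [->|n0] := eqVneq (inner x y) 0; first by rewrite normr0 mulr_ge0.
pose w := (inner x y)^*%C / `|inner x y|.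
have n1 : `|inner x y| != 0 by rewrite normr_eq0.
have wE : inner (w *: x) y = `|inner x y|.
  by rewrite linearZl_LR /= /w mulrAC (mulrC (_^*%C)) -sqr_normc expr2 mulfK.
have w1 : `|w| = 1 by rewrite /w normrM normcJ normfV normr_id divff.
have : (rip (w *: x) y)%:C = `|inner x y|.
  rewrite /rip wE; have := normr_ge0 (inner x y).
  by rewrite lecE; case: `|inner x y| => a b /= /andP[/eqP->].
have <- : `|w *: x| = `|x| by rewrite normrZ w1 mul1r.
move=> <-; rewrite !normE -rmorphM lecR.
rewrite (le_trans (ler_norm _))// -(@ler_pXn2r _ 2)// ?nnegrE ?mulr_ge0 ?rn_ge0//.
by rewrite real_normK ?num_real// exprMn rip_CS.
Qed.

Lemma inner_inj x y : (forall v, inner v x = inner v y) -> x = y.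
Proof.
move=> xy; apply/eqP; rewrite -subr_eq0 -normr_eq0.
have /eqP : `|x - y| ^+ 2 = 0 by rewrite -inner_normE linearBr /= xy subrr.
by rewrite expf_eq0.
Qed.

End Riesz.

Section Adjoint.
Variables (R : realType) (H : hilbertType R).
Implicit Types A B S : bop H.

Lemma adjoint_exists A :
  exists S, forall x y : H, inner (A x) y = inner x (S y).
Proof.
have [M AM] := bop_bounded A.
have /choice[S SP] (y : H) : exists u, forall x, inner (A x) y = inner x u.
  apply: riesz; first by move=> a u v; rewrite linearP linearPl.
  exists (M * complex.Re `|y|) => x; rewrite (le_trans (inner_CS _ _))//.
  have yE : `|y| = (complex.Re `|y|)%:C.
    by have := normr_ge0 y; rewrite lecE; case: `|y| => a b /= /andP[/eqP->].
  by rewrite rmorphM /= -yE mulrAC ler_wpM2r.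
have Sb : S \in @bounded_linear R H.
  apply/bounded_linearP; split=> [a u v|].
    by apply: inner_inj => w; rewrite -SP !linearPr /= -!SP.
  exists M => y; have [->|Sy0] := eqVneq (S y) 0.
    by rewrite normr0 (le_trans _ (AM y)).
  rewrite -(@ler_pM2l _ `|S y|) ?normr_gt0// -expr2 -inner_normE -SP.
  have : `|inner (A (S y)) y| = inner (A (S y)) y.
    by rewrite SP inner_normE ger0_norm// exprn_ge0.
  move=> <-; rewrite (le_trans (inner_CS _ _))//.
  by rewrite mulrCA mulrA ler_wpM2r.
by exists (BOp Sb) => x y; rewrite SP.
Qed.

Definition adjoint A : bop H := sval (cid (adjoint_exists A)).

Lemma adjointP A (x y : H) : inner (A x) y = inner x (adjoint A y).
Proof. by rewrite /adjoint; case: cid. Qed.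

Lemma adjoint_unique A S :
  (forall x y : H, inner (A x) y = inner x (S y)) -> S = adjoint A.
Proof.
by move=> AS; apply/bop_eqP => y; apply: inner_inj => x; rewrite -AS adjointP.
Qed.

Definition is_normal A := adjoint A * A = A * adjoint A.

Definition is_binormal A :=
  (adjoint A * A) * (A * adjoint A) = (A * adjoint A) * (adjoint A * A).

End Adjoint.

(* Main.v *)
(* Write T' for the adjoint of T. By the Fuglede-Putnam theorem applied to the
   normal operators B and lambda B, A intertwines their adjoints too; since
   |lambda| = 1, both A'A and AA' then commute with B and B'. Hence
   (AB)'(AB) = (B'B)(A'A) and (AB)(AB)' = (B'B)(AA'), whose factors all commute.

   Fuglede-Putnam (A N = M A implies A N' = M' A) follows Rosenblum's argument
   with (1 + w T)^n in place of the exponential: since a normal operator and its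
   adjoint have the same norm on each vector, (1 + w M')^n A (1 - w N')^n is
   bounded by |A| (1 + |w|^2 |N|^2)^n, and Cauchy's estimate for the coefficient
   n (M' A - A N') of w forces it to vanish. Cauchy's estimate for a polynomial
   on a circle is obtained by averaging over z and - z, which keeps the even
   part, and iterating after the substitution of z for z ^ 2. *)
Require Import Defs.
From mathcomp Require Import all_boot all_order all_algebra.
From mathcomp Require Import all_classical all_reals all_analysis.
From mathcomp Require Import ring lra.
From mathcomp.real_closed Require Import complex.
Import Order.TTheory GRing.Theory Num.Theory.
Import numFieldNormedType.Exports.
Local Open Scope ring_scope.

Set Implicit Arguments.
Unset Strict Implicit.
Unset Printing Implicit Defensive.

(** * Cauchy's estimate for polynomials with vector coefficients *)

Section CauchyEstimate.
Variables (C : numClosedFieldType) (V : normedModType C).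
Variables (I : finType) (a : I -> V).

Lemma sqrt_norm (r v : C) : 0 <= r -> `|v| = r ^+ 2 ->
  exists2 z : C, `|z| = r & z ^+ 2 = v.
Proof.
move=> r0 vr; exists (sqrtC v); last exact: sqrtCK.
by apply/eqP; rewrite -(@eqrXn2 _ 2)// -normrX sqrtCK vr.
Qed.

(** The sum at [z] plus [(-1) ^ b] times the sum at [- z] doubles the terms of parity [b] and
    cancels the others. *)
Lemma norm_parity_part_le (P : pred I) (d : I -> nat) (r c : C) (b : bool) :
  (forall z, `|z| = r -> `|\sum_(i | P i) z ^+ d i *: a i| <= c) ->
  forall z, `|z| = r ->
    `|\sum_(i | P i && (odd (d i) == b)) z ^+ d i *: a i| <= c.
Proof.
move=> bnd z zr; have Nzr : `|- z| = r by rewrite normrN.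
have := lerD (bnd z zr) (bnd (- z) Nzr).
have signE : `|(-1) ^+ b : C| = 1 by rewrite normrX normrN1 expr1n.
rewrite -[X in _ + X <= _]mul1r -signE -normrZ.
move=> /(le_trans (ler_normD _ _)); rewrite scaler_sumr -big_split/=.
rewrite (bigID (fun i => odd (d i) == b))/= addrC.
rewrite big1 ?add0r => [|i /andP[_ db]].
  rewrite (eq_bigr (fun i => (z ^+ d i *: a i) *+ 2)) => [|i /andP[_ /eqP <-]].
    by rewrite sumrMnl normrMn -mulr2n lerMn2r.
  rewrite scalerA (exprNn z) -(signr_odd _ (d i)) mulrA.
  by rewrite -signr_addb addbb mul1r mulr2n.
rewrite scalerA (exprNn z) -(signr_odd _ (d i)) mulrA -signr_addb.
have -> : b (+) odd (d i) by case: b (odd (d i)) db {signE} => [] [].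
by rewrite mulN1r scaleNr subrr.
Qed.

(** Induction on [k] with all degrees below [2 ^ k]: the even part is a polynomial in [z ^ 2], so
    one round halves the degrees and squares the radius. *)
Lemma norm_const_coef_le (P : pred I) (d : I -> nat) (r c : C) : 0 <= r ->
  (forall z, `|z| = r -> `|\sum_(i | P i) z ^+ d i *: a i| <= c) ->
  `|\sum_(i | P i && (d i == 0)) a i| <= c.
Proof.
have [k] : exists k, forall i, P i -> (d i < 2 ^ k)%N.
  exists (\max_(i | P i) d i)%N => i Pi.
  by apply: leq_ltn_trans (leq_bigmax_cond _ Pi) (ltn_expl _ _).
elim: k P d r c => [|k IHk] P d r c dk r0 bnd.
  have := bnd r (ger0_norm r0); rewrite big_mkcondr/=.
  under eq_bigr => i Pi.
    have /eqP-> : d i == 0 by rewrite -leqn0 -ltnS dk.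
    rewrite scale1r; over.
  rewrite (eq_bigr a)// => i Pi.
  by have -> : d i == 0 by rewrite -leqn0 -ltnS dk.
have := IHk [pred i | P i && (odd (d i) == false)] (fun i => (d i)./2)
  (r ^+ 2) c.
(* Degree 1 also has half 0; the parity condition excludes it. *)
rewrite (eq_bigl (fun i => P i && (d i == 0)))/=; last first.
  move=> i; rewrite -andbA; congr (_ && _).
  by case: (d i) => [|[|n]] //; rewrite andbF.
apply; rewrite ?exprn_ge0//.
  move=> i /andP[Pi _]; rewrite -ltn_double -[ltnRHS]mul2n -expnS.
  by rewrite (leq_ltn_trans _ (dk _ Pi))// -[leqRHS]odd_double_half leq_addl.
move=> v vr; have [z zr zv] := sqrt_norm r0 vr.
have := norm_parity_part_le false bnd zr.
rewrite (eq_bigr (fun i => v ^+ (d i)./2 *: a i))// => i /andP[_ /eqP di].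
by rewrite -zv -exprM mul2n -{1}(odd_double_half (d i)) di.
Qed.

(** The odd part is [z] times a polynomial in [z ^ 2] whose constant term is the coefficient
    sought. *)
Lemma norm_linear_coef_le (d : I -> nat) (r c : C) : 0 < r ->
  (forall z, `|z| = r -> `|\sum_i z ^+ d i *: a i| <= c) ->
  r * `|\sum_(i | d i == 1) a i| <= c.
Proof.
move=> r0 bnd; rewrite mulrC -ler_pdivlMr//.
have := @norm_const_coef_le (fun i => odd (d i) == true) (fun i => (d i)./2)
  (r ^+ 2) (c / r).
rewrite (eq_bigl (fun i => d i == 1))/=; last first.
  by move=> i; case: (d i) => [|[|[|n]]] //=; rewrite andbF.
apply; first by rewrite exprn_ge0 ?ltW.
move=> v vr; have [z zr zv] := sqrt_norm (ltW r0) vr.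
have := norm_parity_part_le true bnd zr.
rewrite (eq_bigr (fun i => z *: (v ^+ (d i)./2 *: a i))) => [|i /eqP di].
  by rewrite -scaler_sumr normrZ zr mulrC -ler_pdivlMr.
by rewrite scalerA -zv -exprM mul2n -exprS -{1}(odd_double_half (d i)) di.
Qed.

End CauchyEstimate.

(** * Algebra of adjoints and normal operators *)

Section FugledePutnam.
Variables (R : realType) (H : hilbertType R).
Implicit Types (A B M N T : bop H) (w : R[i]) (x y : H).

Lemma adjointK A : adjoint (adjoint A) = A.
Proof.
by apply/esym/adjoint_unique => x y; rewrite innerC -adjointP -innerC.
Qed.

Lemma adjoint1 : adjoint (1 : bop H) = 1.
Proof. by apply/esym/adjoint_unique. Qed.

Lemma adjointM A B : adjoint (A * B) = adjoint B * adjoint A.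
Proof.
by apply/esym/adjoint_unique => x y; rewrite !bopME !adjointP.
Qed.

Lemma adjointD A B : adjoint (A + B) = adjoint A + adjoint B.
Proof.
apply/esym/adjoint_unique => x y.
by rewrite !bopDE linearDl linearDr /= !adjointP.
Qed.

Lemma adjointZ w A : adjoint (w *: A) = w^* *: adjoint A.
Proof.
apply/esym/adjoint_unique => x y.
by rewrite !bopZE linearZl_LR linearZr_LR /= !adjointP conjCK.
Qed.

Lemma adjointX A n : adjoint (A ^+ n) = adjoint A ^+ n.
Proof.
elim: n => [|n IHn]; first exact: adjoint1.
by rewrite exprS exprSr adjointM IHn.
Qed.

Lemma bop_exprZ w A n : (w *: A) ^+ n = w ^+ n *: A ^+ n.
Proof.
elim: n => [|n IHn]; first by rewrite scale1r.
by rewrite !exprS IHn -bop_scaleAl -bop_scaleAr scalerA.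
Qed.

Lemma bop_linearZ A w x : A (w *: x) = w *: A x.
Proof. by rewrite linearZ. Qed.

Lemma bop_sumE (I : Type) (s : seq I) (F : I -> bop H) x :
  (\sum_(i <- s) F i) x = \sum_(i <- s) F i x.
Proof. exact: (big_morph (fun A : bop H => A x)). Qed.

(** Positivity matters because [fuglede_putnam] divides by the constant for [adjoint N]. *)
Lemma bop_bounded_gt0 A :
  exists2 c : R, 0 < c & forall x, `|A x| <= c%:C%C * `|x|.
Proof.
have [c Ac] := bop_bounded A; exists (`|c| + 1) => [|x].
  by rewrite ltr_pwDr.
by rewrite (le_trans (Ac x))// ler_wpM2r// lecR (le_trans (ler_norm c))// lerDl.
Qed.

(** With [N'] for the adjoint, the two squared norms are the inner products of [x] with [N N' x] and
    with [N' N x]. *)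
Lemma norm_adjoint_normal N x : is_normal N -> `|adjoint N x| = `|N x|.
Proof.
move=> nN; apply/eqP; rewrite -(@eqrXn2 _ 2)// -!inner_normE.
by rewrite adjointP adjointK -!bopME -nN [eqbRHS]adjointP.
Qed.

Lemma is_normalX N n : is_normal N -> is_normal (N ^+ n).
Proof.
by move=> nN; rewrite /is_normal adjointX; apply/commrX/commr_sym/commrX.
Qed.

Lemma is_normalZ w N : is_normal N -> is_normal (w *: N).
Proof.
rewrite /is_normal adjointZ -!bop_scaleAl -!bop_scaleAr scalerA mulrC -scalerA.
by move=> ->.
Qed.

Lemma is_normal1D N : is_normal N -> is_normal (1 + N).
Proof.
move=> nN; rewrite /is_normal adjointD adjoint1.
by rewrite !mulrDl !mulrDr nN !mul1r !mulr1 addrACA.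
Qed.

(** * Rosenblum's argument with binomial powers *)

Lemma intertwine_1DX A M N w n : A * N = M * A ->
  A * (1 + w *: N) ^+ n = (1 + w *: M) ^+ n * A.
Proof.
move=> AN; elim: n => [|n IHn]; first by rewrite mulr1 mul1r.
rewrite exprSr mulrA IHn -mulrA mulrDr mulr1 -bop_scaleAr AN exprSr -mulrA.
by rewrite mulrDl mul1r bop_scaleAl.
Qed.

(** Two binomial expansions, indexed by pairs so that the polynomial in [w] has the shape treated by
    [norm_linear_coef_le]. *)
Lemma sandwichE (U V A : bop H) w n x :
  ((1 + w *: U) ^+ n * A * (1 + w *: V) ^+ n) x =
  \sum_(p : 'I_n.+1 * 'I_n.+1)
    w ^+ (p.1 + p.2) *: (('C(n, p.1) * 'C(n, p.2))%:R *:
      (U ^+ p.1) (A ((V ^+ p.2) x))).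
Proof.
rewrite ![1 + _]addrC !exprD1n -mulrA mulr_suml bop_sumE.
rewrite -(pair_bigA _ (fun i j : 'I_n.+1 =>
  w ^+ (i + j) *: (('C(n, i) * 'C(n, j))%:R *: (U ^+ i) (A ((V ^+ j) x)))))/=.
apply: eq_bigr => i _. rewrite bop_sumE !linear_sum /=; apply: eq_bigr => j _.
rewrite !bop_exprZ -[_ *+ 'C(n, i)]scaler_nat -[_ *+ 'C(n, j)]scaler_nat.
rewrite !bopZE !bop_linearZ !scalerA.
by congr (_ *: _); rewrite natrM exprD; ring.
Qed.

(** Only the pairs [(1, 0)] and [(0, 1)] have degree 1, each with binomial weight [n]; [0 < n] puts
    the index 1 in range. *)
Lemma sandwich_linear_coef (U V A : bop H) n x : (0 < n)%N ->
  \sum_(p : 'I_n.+1 * 'I_n.+1 | (p.1 + p.2)%N == 1)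
    ('C(n, p.1) * 'C(n, p.2))%:R *: (U ^+ p.1) (A ((V ^+ p.2) x)) =
  n%:R *: (U * A + A * V) x.
Proof.
case: n => // n _.
rewrite (bigD1 (lift ord0 ord0, ord0))//= (bigD1 (ord0, lift ord0 ord0))//=.
rewrite big1 => [|[i j]]/=.
  by rewrite addr0 !bin1 !bin0 muln1 mul1n scalerDr.
case: i j => [[|[|i]] ?] [[|[|j]] ?].
all: by [].
Qed.

Lemma norm_bopX_le T (b : R[i]) n x : 0 <= b ->
  (forall y, `|T y| <= b * `|y|) -> `|(T ^+ n) x| <= b ^+ n * `|x|.
Proof.
move=> b0 Tb; elim: n => [|n IHn]; first by rewrite mul1r.
by rewrite !exprS bopME (le_trans (Tb _))// -mulrA ler_wpM2l.
Qed.

(** Write [v] for the conjugate of [w] and primes for adjoints. By normality [(1 + w M')^n] may be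
    replaced by its adjoint [(1 + v M)^n], which passes through [A] as [(1 + v N)^n]; that is traded
    for [(1 + w N')^n], which combines with the last factor into [(1 - w^2 N'^2)^n]. *)
Lemma norm_sandwich_le A M N w (a c : R[i]) n x :
  is_normal M -> is_normal N -> A * N = M * A -> 0 <= a -> 0 <= c ->
  (forall y, `|A y| <= a * `|y|) -> (forall y, `|adjoint N y| <= c * `|y|) ->
  `|((1 + w *: adjoint M) ^+ n * A * (1 + w *: - adjoint N) ^+ n) x| <=
    a * (1 + (`|w| * c) ^+ 2) ^+ n * `|x|.
Proof.
move=> nM nN AN a0 c0 Aa Nc.
have adjE T : (1 + w *: adjoint T) ^+ n = adjoint ((1 + w^* *: T) ^+ n).
  by rewrite adjointX adjointD adjoint1 adjointZ conjCK.
have nX T : is_normal T -> is_normal ((1 + w^* *: T) ^+ n).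
  by move=> nT; apply/is_normalX/is_normal1D/is_normalZ.
rewrite -mulrA !bopME adjE (norm_adjoint_normal _ (nX _ nM)).
rewrite -[X in `|X|]bopME -(intertwine_1DX _ _ AN) bopME (le_trans (Aa _))//.
rewrite -mulrA ler_wpM2l// -(norm_adjoint_normal _ (nX _ nN)).
rewrite -adjE -bopME -exprMn_comm.
  apply: norm_bopX_le => [|y]; first by rewrite addr_ge0// exprn_ge0// mulr_ge0.
  rewrite scalerN mulrBr mulr1 mulrDl mul1r opprD addrA addrK.
  rewrite -bop_scaleAl -bop_scaleAr scalerA bopDE bopNE bopZE.
  rewrite (le_trans (ler_normB _ _))// mulrDl mul1r lerD2l.
  rewrite bopME normrZ normrM exprMn -expr2 -[leRHS]mulrA.
  rewrite ler_wpM2l ?exprn_ge0//.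
  by rewrite expr2 -mulrA (le_trans (Nc _))// ler_wpM2l.
rewrite scalerN; apply: commrB; first exact: commr1.
by apply/commr_sym/commrD; first exact: commr1.
Qed.

Lemma norm_realE x : `|x| = (complex.Re `|x|)%:C%C.
Proof.
by have := normr_ge0 x; rewrite lecE; case: `|x| => u v /= /andP[/eqP->].
Qed.

(** By induction [(1 + s)^n (1 - n s) <= 1], and here the second factor is at least 1/2. *)
Lemma expr1D_le2 (s : R) n : 0 <= s -> n%:R * s <= 2^-1 -> (1 + s) ^+ n <= 2.
Proof.
move=> s0 ns; have s1 : 0 < 1 + s by rewrite ltr_pwDl.
have : (1 + s) ^+ n * (1 - n%:R * s) <= 1.
  elim: n {ns} => [|n IHn]; first by rewrite mul0r subr0 mul1r.
  apply: le_trans IHn; rewrite exprSr -mulrA ler_wpM2l ?exprn_ge0 ?(ltW s1)//.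
  have : 0 <= n.+1%:R * s ^+ 2 by rewrite mulr_ge0 ?exprn_ge0.
  by rewrite -natr1 => h; lra.
have P0 : 0 <= (1 + s) ^+ n by rewrite exprn_ge0 ?ltW.
by have := ler_wpM2l P0 ns; lra.
Qed.

(* The bound stays at most 2 |A| |x| when [|w| c = 1 / (2k)] and [n = k ^ 2],
   while the coefficient of [w], scaled by [|w|], is [k / (2c)] times
   [(adjoint M * A - A * adjoint N) x]. *)
Lemma fuglede_putnam A M N : is_normal M -> is_normal N ->
  A * N = M * A -> A * adjoint N = adjoint M * A.
Proof.
(* The sign is moved onto [adjoint N] to match the sum in [sandwich_linear_coef]. *)
move=> nM nN AN; apply/esym/eqP; rewrite -subr_eq0 -mulrN.
apply/eqP/bop_eqP => x.
have [a a0 Aa] := bop_bounded_gt0 A.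
have [c c0 Nc] := bop_bounded_gt0 (adjoint N).
set D : bop H := _ + _.
have kD (k : nat) : (0 < k)%N -> k%:R * `|D x| <= (4 * a * c)%:C%C * `|x|.
  move=> k0; pose r : R := (2 * c * k%:R)^-1.
  have k0R : 0 < k%:R :> R by rewrite ltr0n.
  have r0 : 0 < r by rewrite invr_gt0 !mulr_gt0.
  have k20 : (0 < k ^ 2)%N by rewrite expn_gt0 k0.
  have := @norm_linear_coef_le _ _ _ (fun p : 'I_(k ^ 2).+1 * 'I_(k ^ 2).+1 =>
    ('C(k ^ 2, p.1) * 'C(k ^ 2, p.2))%:R *:
      (adjoint M ^+ p.1) (A (((- adjoint N) ^+ p.2) x)))
    (fun p => (p.1 + p.2)%N) r%:C%C ((a * 2)%:C%C * `|x|).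
  rewrite sandwich_linear_coef// normrZ normr_nat ltcR => /(_ r0).
  have bnd z : `|z| = r%:C%C ->
    `|\sum_(p : 'I_(k ^ 2).+1 * 'I_(k ^ 2).+1) z ^+ (p.1 + p.2) *:
      (('C(k ^ 2, p.1) * 'C(k ^ 2, p.2))%:R *:
      (adjoint M ^+ p.1) (A (((- adjoint N) ^+ p.2) x)))| <=
    (a * 2)%:C%C * `|x|.
    move=> zr; rewrite -sandwichE.
    have a0C : 0 <= a%:C%C :> R[i] by rewrite lecR ltW.
    have c0C : 0 <= c%:C%C :> R[i] by rewrite lecR ltW.
    rewrite (le_trans (norm_sandwich_le _ _ _ nM nN AN a0C c0C Aa Nc))//.
    rewrite ler_wpM2r// zr -rmorphM -rmorphXn -(rmorph1 (real_complex R)).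
    rewrite -rmorphD -rmorphXn -rmorphM lecR ler_wpM2l ?(ltW a0)//.
    apply: expr1D_le2; first by rewrite exprn_ge0// mulr_ge0 ?ltW.
    have -> : (k ^ 2)%:R * (r * c) ^+ 2 = 4^-1 :> R.
      by rewrite natrX /r; field; rewrite !gt_eqF.
    by rewrite lef_pV2 ?posrE// ler_nat.
  move=> /(_ bnd); rewrite (norm_realE x) (norm_realE (D x)).
  set t := complex.Re _; set u := complex.Re _.
  rewrite -(rmorph_nat (real_complex R) k).
  rewrite -(rmorph_nat (real_complex R) (k ^ 2)).
  rewrite -!rmorphM !lecR natrX.
  have -> : r * (k%:R ^+ 2 * t) = k%:R * t / (2 * c).
    by rewrite /r; field; rewrite !gt_eqF.
  by rewrite ler_pdivrMr ?mulr_gt0//; lra.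
change (D x = 0).
(* By [kD] all multiples [k |D x|] stay below one constant, so the archimedean property rules out
   [|D x| > 0]. *)
apply/eqP; rewrite -normr_le0 norm_realE lecR leNgt; apply/negP => t0.
set t := complex.Re _ in t0; set u := complex.Re `|x|.
have u0 : 0 <= u by have := normr_ge0 x; rewrite norm_realE lecR.
have K0 : 0 <= 4 * a * c * u / t.
  by rewrite divr_ge0 ?(ltW t0)// !mulr_ge0 ?(ltW a0) ?(ltW c0).
have := archi_boundP K0; set k := Num.bound _ => kK.
have := kD k; rewrite -(ltr0n R) (le_lt_trans K0 kK) => /(_ isT).
rewrite (norm_realE x) (norm_realE (D x)) -(rmorph_nat (real_complex R) k).
by rewrite -!rmorphM lecR leNgt -ltr_pdivrMr// kK.
Qed.

End FugledePutnam.

(** * Binormality of the product *)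

Theorem theorem2p3 (R : realType) (H : hilbertType R) (A B : bop H)
    (lambda : R[i]) :
  is_binormal A -> is_normal B ->
  A * B = lambda *: (B * A) -> A * B != 0 ->
  `|lambda| = 1 ->
  is_binormal (A * B).
Proof.
move=> bA nB AB _ l1.
have ll : lambda * lambda^* = 1 by rewrite -normCK l1 expr1n.
have AaB : A * adjoint B = lambda^* *: (adjoint B * A).
  rewrite (@fuglede_putnam _ _ A (lambda *: B) B) ?adjointZ -?bop_scaleAl//.
  exact: is_normalZ.
(* The adjoint of [AaB] reads [B A' = lambda A' B]; multiplying by the conjugate of [lambda] inverts
   it. *)
have aAB : adjoint A * B = lambda^* *: (B * adjoint A).
  have := congr1 (@adjoint _ _) AaB.
  rewrite adjointZ !adjointM !adjointK conjCK => ->.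
  by rewrite scalerA mulrC ll scale1r.
(* Passing [B] through [A] and [A'] produces [lambda] and its conjugate, whose product is 1. *)
have BP : GRing.comm B (adjoint A * A).
  by rewrite /GRing.comm -mulrA AB -bop_scaleAr [in RHS]mulrA aAB -bop_scaleAl
    scalerA ll scale1r mulrA.
have BQ : GRing.comm B (A * adjoint A).
  by rewrite /GRing.comm -mulrA aAB -bop_scaleAr [in RHS]mulrA AB -bop_scaleAl
    scalerA mulrC ll scale1r mulrA.
(* Since [T' T] is self-adjoint, taking adjoints replaces [B] by [B'] and swaps the two sides. *)
have adj_comm T : GRing.comm B (adjoint T * T) ->
    GRing.comm (adjoint B) (adjoint T * T).
  move=> /(congr1 (@adjoint _ _)).
  by rewrite !adjointM !adjointK => /esym.
have aBP := adj_comm _ BP.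
have aBQ : GRing.comm (adjoint B) (A * adjoint A).
  by have := adj_comm (adjoint A); rewrite adjointK; apply.
have lE : adjoint (A * B) * (A * B) = (adjoint B * B) * (adjoint A * A).
  by rewrite adjointM -mulrA [adjoint A * _]mulrA -BP mulrA.
(* Normality of [B] lets both products share the factor [B' B]. *)
have rE : (A * B) * adjoint (A * B) = (adjoint B * B) * (A * adjoint A).
  rewrite adjointM nB AB -bop_scaleAl -mulrA [A * _]mulrA AaB -!bop_scaleAl.
  by rewrite -bop_scaleAr scalerA ll scale1r !mulrA.
rewrite /is_binormal lE rE.
set n := adjoint B * B; set P := adjoint A * A; set Q := A * adjoint A.
have nP : GRing.comm n P by apply/commr_sym/commrM; apply/commr_sym.
have nQ : GRing.comm n Q by apply/commr_sym/commrM; apply/commr_sym.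
have PQ : GRing.comm P Q := bA.
apply: commrM.
  by apply/commr_sym/commrM => //; exact: commr_refl.
by apply/commr_sym/commrM; apply/commr_sym.
Qed.
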